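(* If $H$ is an L-subgyrogroup of a gyrogroup $G$, then the set $\{a\oplus H : a\in G\}$ of left cosets forms a disjoint partition of $G$.
   Context: A gyrogroup is a nonempty set $G$ with a binary operation $\oplus$ such that: (G1) there is $0\in G$ with $0\oplus a=a$ for all $a$; (G2) for each $a$ there is $b$ with $b\oplus a=0$; (G3) for all $a,b\in G$ there is an automorphism $\mathrm{gyr}[a,b]$ of $(G,\oplus)$ (a bijection $G\to G$ preserving $\oplus$) with $a\oplus(b\oplus c)=(a\oplus b)\oplus\mathrm{gyr}[a,b]c$ for all $c\in G$; (G4) $\mathrm{gyr}[a,b]=\mathrm{gyr}[a\oplus b,b]$ for all $a,b\in G$. It is known that $0$ is a two-sided identity, every $a$ has a two-sided inverse $\ominus a$, and $\mathrm{gyr}[a,b]c=\ominus(a\oplus b)\oplus(a\oplus(b\oplus c))$. A nonempty subset $H$ of $G$ is a subgyrogroup if $H$ is a gyrogroup under the operation inherited from $G$ and, for all $a,b\in H$, the restriction of $\mathrm{gyr}[a,b]$ to $H$ is an automorphism of $H$. A subgyrogroup $H$ of $G$ is an L-subgyrogroup if $\mathrm{gyr}[a,h](H)=H$ for all $a\in G$ and $h\in H$. The left coset of $H$ induced by $a$ is $a\oplus H:=\{a\oplus h:h\in H\}$. *)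

(* Defs.v *)
From mathcomp Require Import all_boot.
From mathcomp Require Import boolp classical_sets functions.

Set Implicit Arguments.
Unset Strict Implicit.
Unset Printing Implicit Defensive.

Local Open Scope classical_set_scope.

(* The axioms are relativised to a set A of the ambient type, so that the same
   definition serves for a whole type (A = setT) and for a subset with the
   inherited operation.  Only the values of [op], [gyr a b] (a, b in A) on A
   are constrained. *)

Definition automorphism_on (T : Type) (A : set T) (op : T -> T -> T)
    (f : T -> T) : Prop :=
  set_bij A A f /\
  forall x y : T, A x -> A y -> f (op x y) = op (f x) (f y).

Record gyrogroup_on (T : Type) (A : set T) (op : T -> T -> T) (zero : T)
    (gyr : T -> T -> T -> T) : Prop := GyrogroupOn {
  gyro_nonempty : A !=set0;
  gyro_closed : forall a b, A a -> A b -> A (op a b);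
  gyro_zero : A zero;
  gyro_add0 : forall a, A a -> op zero a = a;
  gyro_inv : forall a, A a -> exists2 b, A b & op b a = zero;
  gyro_aut : forall a b, A a -> A b -> automorphism_on A op (gyr a b);
  gyro_assoc : forall a b c, A a -> A b -> A c ->
    op a (op b c) = op (op a b) (gyr a b c);
  gyro_loop : forall a b c, A a -> A b -> A c ->
    gyr a b c = gyr (op a b) b c
}.

Structure gyrogroup := Gyrogroup {
  gyro_sort :> Type;
  gadd : gyro_sort -> gyro_sort -> gyro_sort;
  gzero : gyro_sort;
  gyr : gyro_sort -> gyro_sort -> gyro_sort -> gyro_sort;
  gyrogroupP : gyrogroup_on [set: gyro_sort] gadd gzero gyr
}.

Section Subgyrogroups.
Variable G : gyrogroup.
Implicit Types (H : set G) (a : G).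

(* The identity and the gyrations that make H a gyrogroup are not assumed to be
   those of G; the second clause is about the gyrations of G. *)
Definition subgyrogroup H : Prop :=
  (exists (zero' : G) (gyr' : G -> G -> G -> G),
     gyrogroup_on H (@gadd G) zero' gyr') /\
  (forall a b : G, H a -> H b -> automorphism_on H (@gadd G) (gyr a b)).

Definition L_subgyrogroup H : Prop :=
  subgyrogroup H /\ forall a h : G, H h -> gyr a h @` H = H.

Definition left_coset a H : set G := [set gadd a h | h in H].

Definition left_cosets H : set (set G) := [set left_coset a H | a in [set: G]].

End Subgyrogroups.

(* Main.v *)
Require Import Defs.
From mathcomp Require Import all_boot.
From mathcomp Require Import boolp classical_sets functions.

(** The theorem holds because a left coset is determined by any of its members:
    if [x = a (+) h] with [h] in [H], then [x (+) H = a (+) H].  Two cosets with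
    a common member are then equal, and every [a] lies in [a (+) H] since
    [a = a (+) 0].

    To see that [x (+) H = a (+) H], read the gyroassociative law
    [a (+) (h (+) k) = (a (+) h) (+) gyr[a,h] k] as [k] runs through [H].
    The left side runs through [a (+) (h (+) H) = a (+) H], because translation
    by a member of [H] permutes [H]; the right side runs through
    [(a (+) h) (+) gyr[a,h] H], which is [(a (+) h) (+) H] by the defining
    property of L-subgyrogroups ([left_coset_eq]).

    The gyrogroup axioms provide only a left identity and left inverses, so the
    left cancellation laws have to be derived.  The decisive one is
    [b (+) (a (+) c) = c] when [b (+) a = 0] ([gaddKl]), which is where the loop
    property enters. *)

Local Open Scope classical_set_scope.

Section GyrogroupTheory.
Variable G : gyrogroup.
Implicit Types a b c : G.

Lemma gadd0l a : gadd (gzero G) a = a.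
Proof. exact: (gyro_add0 (gyrogroupP G)). Qed.

Lemma gaddNl a : exists b, gadd b a = gzero G.
Proof. by have [b _ ba0] := gyro_inv (gyrogroupP G) (I : setT a); exists b. Qed.

Lemma gaddA a b c : gadd a (gadd b c) = gadd (gadd a b) (gyr a b c).
Proof. exact: (gyro_assoc (gyrogroupP G)). Qed.

Lemma gyr_loop a b c : gyr a b c = gyr (gadd a b) b c.
Proof. exact: (gyro_loop (gyrogroupP G)). Qed.

Lemma gyr_inj a b : injective (gyr a b).
Proof.
have [[_ inj_gyr _] _] := gyro_aut (gyrogroupP G) (I : setT a) (I : setT b).
by move=> x y; apply: inj_gyr; rewrite inE.
Qed.

(** Adding a left inverse of [a] on the left turns [gadd a] into a gyration,
    which is injective whatever that gyration is. *)
Lemma gaddI a : injective (gadd a).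
Proof.
move=> x y axy; have [b ba0] := gaddNl a.
by apply: (@gyr_inj b a); rewrite -[LHS]gadd0l -[RHS]gadd0l -ba0 -!gaddA axy.
Qed.

Lemma gyr0 a c : gyr (gzero G) a c = c.
Proof.
by apply: (@gaddI a); have := gaddA (gzero G) a c; rewrite !gadd0l => <-.
Qed.

(** By the loop property [gyr b a = gyr (gadd b a) a = gyr 0 a], which is the
    identity. *)
Lemma gaddKl {a b} : gadd b a = gzero G -> cancel (gadd a) (gadd b).
Proof. by move=> ba0 c; rewrite gaddA gyr_loop ba0 gyr0 gadd0l. Qed.

Lemma gaddNKl {a b} : gadd b a = gzero G -> cancel (gadd b) (gadd a).
Proof. by move=> ba0 c; apply: (@gaddI b); rewrite (gaddKl ba0). Qed.

Lemma gadd0r a : gadd a (gzero G) = a.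
Proof.
by have [b ba0] := gaddNl a; apply: (@gaddI b); rewrite (gaddKl ba0) ba0.
Qed.

End GyrogroupTheory.

Arguments gaddNKl {G a b}.

Section LeftCosets.
Variables (G : gyrogroup) (H : set G).

(** The identity of [H] is idempotent, and by left cancellation the only
    idempotent of [G] is its identity; so [H] has the identity, and hence the
    left inverses, of [G]. *)
Lemma subgyrogroup_closed : subgyrogroup H ->
  [/\ H (gzero G), forall a b, H a -> H b -> H (gadd a b)
    & forall a, H a -> exists2 b, H b & gadd b a = gzero G].
Proof.
move=> [[e [g Hg]] _].
have e0 : e = gzero G.
  by apply: (@gaddI G e); rewrite gadd0r; apply: (gyro_add0 Hg (gyro_zero Hg)).
rewrite -e0; split; [exact: gyro_zero Hg | exact: gyro_closed Hg |].
exact: gyro_inv Hg.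
Qed.

Hypothesis HL : L_subgyrogroup H.

Lemma left_coset_refl a : left_coset a H a.
Proof.
have [H0 _ _] := subgyrogroup_closed (proj1 HL).
by exists (gzero G) => //; apply: gadd0r.
Qed.

(** The inclusion from left to right uses that [gyr a h] maps [H] onto [H], the
    converse that it maps [H] into [H]. *)
Lemma left_coset_eq a h : H h -> left_coset (gadd a h) H = left_coset a H.
Proof.
have [_ HD HN] := subgyrogroup_closed (proj1 HL).
move=> Hh; have gyrH := proj2 HL a h Hh.
apply/seteqP; split=> [_ [k Hk <-]|_ [k Hk <-]].
  have [l Hl <-] : (gyr a h @` H) k by rewrite gyrH.
  by rewrite -gaddA; exists (gadd h l) => //; apply: HD.
have [h' Hh' h'h0] := HN h Hh.
(* [k = h (+) (h' (+) k)] with [h' (+) k] in [H]. *)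
rewrite -(gaddNKl h'h0 k) gaddA.
exists (gyr a h (gadd h' k)) => //.
by rewrite -gyrH; exists (gadd h' k) => //; apply: HD.
Qed.

Lemma left_coset_mem a x : left_coset a H x -> left_coset x H = left_coset a H.
Proof. by move=> [h Hh <-]; apply: left_coset_eq. Qed.

End LeftCosets.

(* [partition D F A]: the sets F i (i in D) cover exactly A, are pairwise
   disjoint and are nonempty; here the family is the set of cosets itself. *)
Theorem theorem4p7 (G : gyrogroup) (H : set G) (HL : L_subgyrogroup H) :
  partition (left_cosets H) (fun C : set G => C) [set: G].
Proof.
split.
- apply/seteqP; split=> // a _.
  by exists (left_coset a H); [exists a | apply: left_coset_refl].
- move=> _ _ [a _ <-] [b _ <-] [x [ax bx]].
  by rewrite -(left_coset_mem _ _ HL _ _ ax) (left_coset_mem _ _ HL _ _ bx).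
- by move=> _ [a _ <-]; exists a; apply: left_coset_refl.
Qed.
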